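(* Let $X$ and $Y$ be zero-dimensional locally compact non-separable metrizable spaces and let $\omega\sigma X=\sigma X\cup\{\Omega\}$ and $\omega\sigma Y=\sigma Y\cup\{\Omega'\}$ be the one-point compactifications of $\sigma X$ and $\sigma Y$, respectively. If $\mathcal{E}_K(X)$ and $\mathcal{E}_K(Y)$ are order-isomorphic, then $\omega\sigma X\setminus X$ and $\omega\sigma Y\setminus Y$ are homeomorphic.
   Context: For a non-compact metrizable space $X$, $\mathcal{E}(X)$ denotes the set of all one-point metrizable extensions of $X$, i.e. metrizable spaces $Y=X\cup\{p\}$ with $p\notin X$ containing $X$ as a dense subspace, where two such extensions are identified if there is a homeomorphism between them fixing $X$ pointwise. $\mathcal{E}(X)$ is partially ordered by: $Y_1\leq Y_2$ if there is a continuous function from $Y_2$ into $Y_1$ fixing $X$ pointwise. For $X$ locally compact, $\mathcal{E}_K(X)$ is the set of those elements of $\mathcal{E}(X)$ that are locally compact, with the induced order. An order-isomorphism is a bijection that preserves order in both directions. A space is zero-dimensional if it has a base of clopen sets. For $X$ locally compact non-separable metrizable, $\sigma X$ is the set of those points of the Stone-Čech compactification $\beta X$ that lie in the closure in $\beta X$ of some $\sigma$-compact subset of $X$; it is an open (hence locally compact) subspace of $\beta X$ containing $X$. *)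

(* Defs.v *)
From HB Require Import structures.
From mathcomp Require Import all_boot all_order all_algebra.
From mathcomp Require Import all_classical all_reals all_analysis.

Set Implicit Arguments.
Unset Strict Implicit.
Unset Printing Implicit Defensive.

Import Order.TTheory GRing.Theory Num.Theory.
Import numFieldNormedType.Exports.

Local Open Scope classical_set_scope.
Local Open Scope ring_scope.

Definition homeomorphism (S T : topologicalType) (f : S -> T) : Prop :=
  continuous f /\
  exists g : T -> S, [/\ continuous g, cancel f g & cancel g f].

Definition homeomorphic (S T : topologicalType) : Prop :=
  exists f : S -> T, homeomorphism f.

Definition metrizable (R : realType) (T : topologicalType) : Prop :=
  exists M : metricType R, homeomorphic T M.

Definition separable (T : topologicalType) : Prop :=
  exists2 A : set T, countable A & dense A.

(* The library's [zero_dimensional] only asks that distinct points be separated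
   by a clopen set, which is weaker in general. *)
Definition has_clopen_base (T : topologicalType) : Prop :=
  exists2 B : set (set T), basis B & B `<=` clopen.

Definition sigma_compact (T : topologicalType) (A : set T) : Prop :=
  exists2 K : nat -> set T, (forall n, compact (K n)) & A = \bigcup_n K n.

(** One-point metrizable extensions *)

(* An extension [X `|` {p}] is presented by a space of arbitrary carrier
   together with an embedding of [X] whose range misses exactly one point. *)
Record one_point_extension (R : realType) (X : topologicalType) := {
  ext_space :> topologicalType ;
  ext_emb : X -> ext_space ;
  ext_pt : ext_space ;
  ext_emb_inj : injective ext_emb ;
  ext_emb_open : forall U : set X,
    open U <-> exists2 V : set ext_space, open V & U = ext_emb @^-1` V ;
  ext_emb_range : range ext_emb = ~` [set ext_pt] ;
  ext_dense : dense (range ext_emb) ;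
  ext_metrizable : metrizable R ext_space }.

Section extension_order.
Variables (R : realType) (X : topologicalType).
Local Notation ext := (one_point_extension R X).

Definition ext_equiv (e1 e2 : ext) : Prop :=
  exists2 h : e1 -> e2, homeomorphism h &
    forall x, h (ext_emb e1 x) = ext_emb e2 x.

Definition ext_le (e1 e2 : ext) : Prop :=
  exists2 f : e2 -> e1, continuous f &
    forall x, f (ext_emb e2 x) = ext_emb e1 x.

(* Elements are the equivalence classes of [ext_equiv].  They are plain
   predicates because [ext] lives above the universe of [set], so that
   [set ext] is not typable. *)
Definition extensions : Type :=
  {C : ext -> Prop | exists e, C = ext_equiv e}.

Definition extensions_le (C1 C2 : extensions) : Prop :=
  exists e1 e2 : ext, [/\ sval C1 e1, sval C2 e2 & ext_le e1 e2].

Definition lc_extensions : Type :=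
  {C : extensions | exists e : ext, sval C e /\ locally_compact [set: e]}.

Definition lc_extensions_le (C1 C2 : lc_extensions) : Prop :=
  extensions_le (sval C1) (sval C2).

End extension_order.

Definition order_isomorphic (A B : Type) (leA : A -> A -> Prop)
    (leB : B -> B -> Prop) : Prop :=
  exists2 f : A -> B, bijective f & forall a b, leA a b <-> leB (f a) (f b).

(** Stone-Cech compactification, as the closure of the image of [X] in the
    cube [[0,1]^C(X,[0,1])] *)

Section stone_cech.
Variables (R : realType) (X : topologicalType).

Definition unit_itv : topologicalType := set_type (`[0 : R, 1 : R]%classic).

Definition cube : topologicalType :=
  prod_topology (fun _ : continuousType X unit_itv => unit_itv).

Definition cube_eval (x : X) : cube := fun f => f x.

Definition stone_cech : topologicalType :=
  set_type (closure (range cube_eval)).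

Lemma stone_cech_emb_subproof (x : X) :
  cube_eval x \in closure (range cube_eval).
Proof. by apply/mem_set/subset_closure; exists x. Qed.

Definition stone_cech_emb (x : X) : stone_cech :=
  exist _ (cube_eval x) (stone_cech_emb_subproof x).

Definition sigma_set : set stone_cech :=
  [set p | exists2 A : set X, sigma_compact A & closure (stone_cech_emb @` A) p].

Definition sigma_space : topologicalType := set_type sigma_set.

Lemma sigma_emb_subproof (x : X) : stone_cech_emb x \in sigma_set.
Proof.
apply/mem_set; exists [set x]; last by apply: subset_closure; exists x.
exists (fun=> [set x]); first by move=> _; exact: compact_set1.
by rewrite bigcup_const//; exists 0%N.
Qed.

Definition sigma_emb (x : X) : sigma_space :=
  exist _ (stone_cech_emb x) (sigma_emb_subproof x).

Definition omega_sigma : topologicalType :=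
  one_point_compactification sigma_space.

Definition omega_sigma_emb (x : X) : omega_sigma := Some (sigma_emb x).

Definition omega_sigma_remainder : topologicalType :=
  set_type (~` range omega_sigma_emb).

End stone_cech.

(* Main.v *)
From HB Require Import structures.
Require Import Defs.
From mathcomp Require Import all_boot all_order all_algebra.
From mathcomp Require Import all_classical all_reals all_analysis.
From mathcomp Require Import lra.

(** The order of the locally compact one-point extensions of X is, turned upside
down, the order of the nonempty compact open subsets of the remainder of X in
its sigma-compact closure; Stone duality then recovers the remainder together
with its point at infinity from that order.

Both sides of this correspondence are coded by the same sets.  Call A, a subset
of X, admissible when it is clopen and sigma-compact but not compact, and
compare admissible sets up to compact sets: A lies below B when the difference
of A and B is relatively compact.

On the side of extensions, A determines the extension by a point p whose
neighbourhoods trace on X the sets U with A minus U relatively compact.  Every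
locally compact extension arises in this way: a compact neighbourhood of p has
compact boundary, and removing a compact clopen set that covers this boundary
leaves an admissible set ([locally_compact_represented]).  Conversely an
admissible A falls into countably many compact clopen layers, and letting the
layers shrink to p yields a metric ([admissible_represented]).  One extension is
below another exactly when their sets compare in the opposite way
([ext_le_represents]).

On the side of the remainder, A determines the set [ends A] of those points that
are in the closure of A.  A clopen subset of X has clopen closure in the
Stone-Cech compactification, because its indicator function extends
([trace_clopen]), so [ends A] is clopen ([ends_clopen]).  It is nonempty because
A is not compact ([ends_nonempty]), and the sets [ends A] separate points
([ends_separates]): every sigma-compact set is contained in a sigma-compact
clopen one ([sigma_compact_hull]), within which disjoint closed sets are
separated by a clopen set ([clopen_separation]).

An order isomorphism therefore pairs the admissible sets of X with those of Y,
preserving comparison, hence also disjointness up to compact sets.  By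
compactness each point of one remainder has a counterpart in the other that lies
in exactly the corresponding clopen sets ([ends_matching]); the point at
infinity is the one that lies in none.  Since the clopen sets separate points,
this correspondence of compact spaces is a homeomorphism
([homeomorphic_of_matching]). *)

Set Implicit Arguments.
Unset Strict Implicit.
Unset Printing Implicit Defensive.

Import Order.TTheory GRing.Theory Num.Theory.
Import numFieldNormedType.Exports.

Local Open Scope classical_set_scope.
Local Open Scope ring_scope.

(** * Compactness *)

Definition relatively_compact (T : topologicalType) (S : set T) : Prop :=
  exists2 K : set T, compact K & S `<=` K.

Section compactness.
Variable T : topologicalType.
Implicit Types (A B K S : set T).

Lemma relatively_compact_sub A B :
  A `<=` B -> relatively_compact B -> relatively_compact A.
Proof. by move=> AB [K cK BK]; exists K => //; exact: subset_trans BK. Qed.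

Lemma relatively_compactU A B : relatively_compact A ->
  relatively_compact B -> relatively_compact (A `|` B).
Proof.
move=> [K cK AK] [L cL BL]; exists (K `|` L); first exact: compactU.
exact: setUSS.
Qed.

Lemma relatively_compact0 : relatively_compact (@set0 T).
Proof. by exists set0 => //; exact: compact0. Qed.

Lemma relatively_compact_closed A :
  closed A -> relatively_compact A -> compact A.
Proof. by move=> cA [K cK AK]; exact: subclosed_compact cA cK AK. Qed.

Lemma compact_relatively A : compact A -> relatively_compact A.
Proof. by move=> cA; exists A. Qed.

(** The covering form of compactness: an ideal of sets that contains a
neighbourhood of each point of K contains K.  Otherwise the complements of its
members would generate a proper filter on K without cluster point. *)
Lemma compact_local_ideal (P : set T -> Prop) K :
  P set0 -> (forall A B, A `<=` B -> P B -> P A) ->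
  (forall A B, P A -> P B -> P (A `|` B)) ->
  compact K -> (forall x, K x -> exists2 U, nbhs x U & P U) -> P K.
Proof.
move=> P0 PS PU cK locP; apply: contrapT => nPK.
pose F : set_system T := [set B | P (K `\` B)].
have FF : ProperFilter F.
  split; first by rewrite /F /= setD0.
  split.
  - by rewrite /F /= setDT.
  - move=> A B FA FB; rewrite /F /= setDIr; exact: PU.
  - by move=> A B AB; rewrite /F /=; apply: PS => x [Kx nB]; split => // /AB.
have FK : F K by rewrite /F /= setDv.
have [x [Kx clx]] := cK F FF FK.
have [U nU PUx] := locP x Kx.
have FU : F (~` U) by rewrite /F /= setDE setCK; exact: PS PUx.
by have [y []] := clx _ _ FU nU.
Qed.

(** Neighbourhoods in T come from neighbourhoods in S, so a cluster point of the
image of a filter is the image of a cluster point. *)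
Lemma compact_preimage_image (S : topologicalType) (A : set T) (f : T -> S) :
  (forall x U, nbhs x U -> exists2 V, nbhs (f x) V & f @^-1` V `<=` U) ->
  compact (f @` A) -> compact A.
Proof.
move=> fin cfA F FF FA.
have [|_ [[x Ax <-] clx]] := cfA (f @ F) _.
  by apply: (@filterS _ F _ A) FA => x Ax; exists x.
exists x; split => // B U FB /fin[V nV VU].
have [|y [[z Bz zy] Vy]] := clx (f @` B) V _ nV.
  by apply: (@filterS _ F _ B) FB => z Bz; exists z.
by exists z; split => //; apply: VU; rewrite /= zy.
Qed.

End compactness.

Lemma set_type_nbhs (T : topologicalType) (A : set T) (x : set_type A)
    (U : set (set_type A)) : nbhs x U ->
  exists2 V, nbhs (set_val x) V & (set_val : set_type A -> T) @^-1` V `<=` U.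
Proof.
rewrite nbhsE => -[W [[V oV <-] Vx] WU]; exists V => //.
by exists V.
Qed.

Lemma compact_set_type (T : topologicalType) (A : set T)
    (B : set (set_type A)) : compact ((set_val : set_type A -> T) @` B) -> compact B.
Proof. by apply: compact_preimage_image => x U; exact: set_type_nbhs. Qed.

Lemma compact_set_typeT (T : topologicalType) (A : set T) :
  compact A -> compact [set: set_type A].
Proof.
move=> cA; apply: compact_set_type; suff -> : set_val @` [set: set_type A] = A by [].
apply/seteqP; split=> [_ [[x xA] _ <-]|x Ax]; first exact/set_mem.
by exists (exist _ x (mem_set Ax)).
Qed.

(** * Stone duality for clopen families *)

Section stone_duality.

Lemma clopen_iff (T : topologicalType) (b : set T) (P : Prop) :
  clopen b -> clopen [set s | b s <-> P].
Proof.
move=> cb; have [p|np] := pselect P.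
  suff -> : [set s | b s <-> P] = b by [].
  by apply/seteqP; split=> s /=; tauto.
suff -> : [set s | b s <-> P] = ~` b by exact: clopenC.
by apply/seteqP; split=> s /=; tauto.
Qed.

(** Each condition on t below is clopen, so by compactness it is enough to meet
finitely many of them at a time. *)
Lemma matching_point (I : choiceType) (S T : topologicalType)
    (a : I -> set S) (b : I -> set T) (s : S) :
  compact [set: T] -> (forall i, clopen (b i)) ->
  (forall D : seq I, exists t, forall i, i \in D -> (b i t <-> a i s)) ->
  exists t, forall i, b i t <-> a i s.
Proof.
move=> cT clb fin.
pose G (D : seq I) := [set t | forall i, i \in D -> (b i t <-> a i s)].
pose F : set_system T := [set B | exists D : seq I, G D `<=` B].
have FF : ProperFilter F.
  split; first by move=> [D GD]; have [t /GD] := fin D.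
  split; first by exists [::].
  - move=> A B [D DA] [E EB]; exists (D ++ E) => t Gt; split.
      by apply: DA => i iD; apply: Gt; rewrite mem_cat iD.
    by apply: EB => i iD; apply: Gt; rewrite mem_cat iD orbT.
  - by move=> A B AB [D DA]; exists D; exact: subset_trans AB.
have [t [_ clt]] := cT F FF filterT.
exists t => i; have [_ cl] := clopen_iff (a i s) (clb i).
apply: cl => V nV; apply: clt nV; exists [:: i] => u; apply.
by rewrite mem_head.
Qed.

Lemma matching_continuous (I : choiceType) (S T : topologicalType)
    (a : I -> set S) (b : I -> set T) (f : S -> T) :
  compact [set: T] -> (forall i, clopen (a i)) -> (forall i, clopen (b i)) ->
  (forall t u : T, t <> u -> exists i, ~ (b i t <-> b i u)) ->
  (forall s i, b i (f s) <-> a i s) -> continuous f.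
Proof.
move=> cT cla clb sepb fab s U nU.
(* If f left V arbitrarily near s, its values outside V would cluster at a point
   outside V; that point has the memberships of f s since the b i are clopen. *)
apply: contrapT => nfU.
have [V [oV Vs VU]] : exists V, [/\ open V, V (f s) & V `<=` U].
  by move: nU; rewrite nbhsE => -[V [? ?] ?]; exists V.
pose F : set_system T :=
  [set B | nbhs s [set x | ~ V (f x) -> B (f x)]].
have FF : ProperFilter F.
  split.
    move=> F0; apply: nfU; apply: (@filterS _ (nbhs s) _ _ _ _ F0) => x nV.
    by apply: VU; apply: contrapT.
  split.
  - by rewrite /F /=; apply: filterE.
  - move=> A B FA FB; apply: (@filterS _ (nbhs s) _ _ _ _
      (@filterI _ (nbhs s) _ _ _ FA FB)) => x [Ax Bx] nV.
    by split; [exact: Ax|exact: Bx].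
  - by move=> A B AB; apply: (@filterS _ (nbhs s)) => x H nV; exact: AB (H nV).
have [t [_ clt]] := cT F FF filterT.
have nVt : ~ V t.
  move=> Vt; have FV : F (~` V) by exact: (@filterE _ (nbhs s) _ _ (fun _ h => h)).
  by have [u []] := clt (~` V) V FV (open_nbhs_nbhs (conj oV Vt)).
have [i] : exists i, ~ (b i t <-> b i (f s)).
  by apply: sepb => tfs; rewrite tfs in nVt.
apply.
have [_ cl] := clopen_iff (b i (f s)) (clb i).
apply: cl => W nW; apply: clt nW.
have [oa _] := clopen_iff (a i s) (cla i).
have na : nbhs s [set x | a i x <-> a i s] by apply: open_nbhs_nbhs.
apply: (@filterS _ (nbhs s) _ _ _ _ na).
by move=> x /= ax _; have := fab x i; have := fab s i; tauto.
Qed.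

(** Points are determined by the clopen sets containing them, so matching points
with equal memberships is a bijection, continuous in both directions. *)
Lemma homeomorphic_of_matching (I : choiceType) (S T : topologicalType)
    (a : I -> set S) (b : I -> set T) :
  compact [set: S] -> compact [set: T] ->
  (forall i, clopen (a i)) -> (forall i, clopen (b i)) ->
  (forall s u : S, s <> u -> exists i, ~ (a i s <-> a i u)) ->
  (forall t u : T, t <> u -> exists i, ~ (b i t <-> b i u)) ->
  (forall s (D : seq I), exists t, forall i, i \in D -> (b i t <-> a i s)) ->
  (forall t (D : seq I), exists s, forall i, i \in D -> (a i s <-> b i t)) ->
  homeomorphic S T.
Proof.
move=> cS cT cla clb sepa sepb finST finTS.
have [f fP] := choice (fun s => matching_point cT clb (finST s)).
have [g gP] := choice (fun t => matching_point cS cla (finTS t)).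
exists f; split; first exact: matching_continuous fP.
exists g; split; first exact: matching_continuous gP.
- move=> s; apply: contrapT => /sepa[i]; apply.
  by have := gP (f s) i; have := fP s i; tauto.
- move=> t; apply: contrapT => /sepb[i]; apply.
  by have := fP (g t) i; have := gP t i; tauto.
Qed.

End stone_duality.

(** * Distances and sigma-compact clopen sets *)

(** Distances are kept as functions on the given space, so that nothing has to be
transported along a homeomorphism with a metric space. *)
Record compatible_distance (R : realType) (X : topologicalType)
    (d : X -> X -> R) : Prop := CompatibleDistance {
  dist_xx : forall x, d x x = 0 ;
  dist_eq0 : forall x y, d x y = 0 -> x = y ;
  dist_sym : forall x y, d x y = d y x ;
  dist_triangle : forall y x z, d x z <= d x y + d y z ;
  dist_nbhsP : forall x (U : set X),
    nbhs x U <-> exists2 e, 0 < e & forall y, d x y < e -> U y }.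

Lemma homeomorphism_nbhs (S T : topologicalType) (f : S -> T) (x : S)
    (U : set S) :
  homeomorphism f -> nbhs x U <-> exists2 V, nbhs (f x) V & f @^-1` V `<=` U.
Proof.
move=> [cf [g [cg fK gK]]]; split.
  move=> nU; exists (g @^-1` U); last by move=> y /=; rewrite fK.
  by apply: cg; rewrite fK.
by move=> [V nV VU]; apply: filterS VU _; exact: cf.
Qed.

Section metrizable_spaces.
Variables (R : realType).

Lemma metrizable_distance (X : topologicalType) : metrizable R X ->
  exists d : X -> X -> R, compatible_distance d.
Proof.
move=> [M [f hf]]; exists (fun x y => mdist (f x) (f y)); split.
- by move=> x; exact: mdistxx.
- move=> x y /mdist_positivity fxy.
  by have [_ [g [_ fK _]]] := hf; rewrite -(fK x) -(fK y) fxy.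
- by move=> x y; exact: metric_sym.
- by move=> y x z; exact: metric_triangle.
- move=> x U; rewrite (homeomorphism_nbhs _ _ hf); split.
    move=> [V]; rewrite -nbhs_ballE => -[e e0 eV] VU; exists e => // y xy.
    by apply: VU; apply: eV; rewrite ballEmdist.
  move=> [e e0 eU]; exists (ball (f x) e); first exact: nbhsx_ballx.
  by move=> y /=; rewrite ballEmdist; exact: eU.
Qed.

Variables (X : topologicalType) (d : X -> X -> R).
Hypothesis dX : compatible_distance d.

Lemma dist_ge0 x y : 0 <= d x y.
Proof.
have := dist_triangle dX y x x; rewrite dist_xx// [d y x]dist_sym//.
by rewrite -mulr2n pmulrn_lge0.
Qed.

Lemma nbhs_dist_ball x e : 0 < e -> nbhs x [set y | d x y < e].
Proof. by move=> e0; apply/(dist_nbhsP dX); exists e. Qed.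

Lemma distance_hausdorff : hausdorff_space X.
Proof.
move=> x y xy; apply: (dist_eq0 dX); apply/eqP.
rewrite eq_le dist_ge0 andbT leNgt; apply/negP => d0.
have d20 : 0 < d x y / 2 by rewrite divr_gt0.
have [z [/= xz yz]] := xy _ _ (nbhs_dist_ball x d20) (nbhs_dist_ball y d20).
have := dist_triangle dX z x y; rewrite leNgt => /negP; apply.
by rewrite [ltRHS]splitr ltrD// (dist_sym dX).
Qed.

(** One compact set serves all points of K at once: near x0, if some x has a
relatively compact e-ball then that ball contains the e/2-balls of all the
points within e/4 of x0. *)
Lemma compact_halo (K : set X) (e : R) : compact K -> 0 < e ->
  exists2 C : set X, compact C & forall x, K x ->
    relatively_compact [set y | d x y < e] ->
    [set y | d x y < e / 2] `<=` C.
Proof.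
move=> cK e0; pose P (S : set X) := exists2 C : set X, compact C &
  forall x, S x -> relatively_compact [set y | d x y < e] ->
    [set y | d x y < e / 2] `<=` C.
apply: (@compact_local_ideal _ P) => //.
- by exists set0 => //; exact: compact0.
- by move=> A B AB [C cC CB]; exists C => // x Ax; apply: CB; exact: AB.
- move=> A B [C cC CA] [D cD DB]; exists (C `|` D); first exact: compactU.
  by move=> x [Ax|Bx] rx y xy; [left; exact: CA rx _ xy|right; exact: DB rx _ xy].
- move=> x0 _; have e40 : 0 < e / 4 by rewrite divr_gt0.
  exists [set x | d x0 x < e / 4]; first exact: nbhs_dist_ball.
  have [[x [xx0 [C cC BC]]]|nx] := pselect (exists x, d x0 x < e / 4 /\
    relatively_compact [set y | d x y < e]).
    exists C => // x' /= x'x0 _ y /= x'y; apply: BC => /=.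
    apply: (le_lt_trans (dist_triangle dX x' _ _)).
    apply: (le_lt_trans (lerD (dist_triangle dX x0 _ _) (lexx _))).
    rewrite (dist_sym dX x x0); lra.
  exists set0; first exact: compact0.
  by move=> x xx0 rx; case: nx; exists x.
Qed.

Lemma small_inv (e : R) : 0 < e -> exists n : nat, n.+1%:R^-1 < e.
Proof.
move=> e0; exists (Num.truncn e^-1).
by rewrite invf_plt ?posrE// truncnS_gt.
Qed.

End metrizable_spaces.

Section zero_dimensional_locally_compact.
Variables (X : topologicalType).
Hypotheses (X0 : has_clopen_base X) (lcX : locally_compact [set: X]).

Lemma locally_compact_nbhs (x : X) :
  exists2 U : set X, nbhs x U & relatively_compact U.
Proof.
have [U nU [cU _]] := lcX (I : [set: X] x).
exists U; last exact: compact_relatively.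
by apply: (@filterS _ (nbhs x) _ _ _ _ nU) => y; exact.
Qed.

Lemma compact_clopen_nbhs (x : X) (U : set X) : nbhs x U ->
  exists C : set X, [/\ clopen C, compact C, C x & C `<=` U].
Proof.
move=> nU; have [V nV rV] := locally_compact_nbhs x.
have [B [Bo Bx] Bc] := X0.
have [C [BC Cx] CUV] := Bx x _ (filterI nU nV).
have cC := Bc _ BC; exists C; split => //.
  apply: relatively_compact_closed; first by case: cC.
  by apply: relatively_compact_sub rV => y /CUV[].
by move=> y /CUV[].
Qed.

Lemma compact_clopen_between (K U : set X) : compact K -> open U ->
  K `<=` U ->
  exists C : set X, [/\ clopen C, compact C, K `<=` C & C `<=` U].
Proof.
move=> cK oU KU.
apply: (@compact_local_ideal _ (fun S => exists C : set X,
  [/\ clopen C, compact C, S `<=` C & C `<=` U])) => //.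
- by exists set0; split => //; [exact: clopen0|exact: compact0].
- move=> A B AB [C [? ? BC ?]]; exists C; split => //.
  exact: subset_trans BC.
- move=> A B [C [? ? AC CU]] [D [? ? BD DU]]; exists (C `|` D); split.
  + exact: clopenU.
  + exact: compactU.
  + exact: setUSS.
  + by rewrite subUset.
- move=> x /KU Ux; have [//|C [clC cC Cx CU]] := @compact_clopen_nbhs x U.
    exact: open_nbhs_nbhs.
  exists C; last by exists C; split.
  by apply: open_nbhs_nbhs; split => //; case: clC.
Qed.

Lemma sigma_compact_subclosed (A B : set X) : closed B -> B `<=` A ->
  sigma_compact A -> sigma_compact B.
Proof.
move=> cB BA [K cK AK]; exists (fun n => K n `&` B).
  by move=> n; exact: compact_closedI.
rewrite -setI_bigcupl -AK; apply/seteqP; split => [x Bx|x []//].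
by split => //; exact: BA.
Qed.

(** Starting from S, the halos of [compact_halo] are added for all radii
1/(n+1), countably often.  The union A is open, as each of its points has a
relatively compact ball, half of which has been added.  It is closed for the
same reason: a limit y of A is within 1/(2(n+1)) of some x in A whose ball of
radius 1/(n+1) is relatively compact, so y was added with x. *)
Lemma sigma_compact_hull (R : realType) (S : set X) : metrizable R X ->
  sigma_compact S ->
  exists A : set X, [/\ clopen A, sigma_compact A & S `<=` A].
Proof.
move=> /metrizable_distance[d dX] [K cK SK].
have inv0 n : 0 < n.+1%:R^-1 :> R by rewrite invr_gt0.
have /choice[H HP] : forall KN : set X * nat, exists H : set X,
    compact KN.1 -> compact H /\ forall x, KN.1 x ->
      relatively_compact [set y | d x y < KN.2.+1%:R^-1] ->
      [set y | d x y < KN.2.+1%:R^-1 / 2] `<=` H.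
  case=> L n /=.
  have [cL|ncL] := pselect (compact L); last by exists set0.
  by have [C ? ?] := compact_halo dX cL (inv0 n); exists C.
(* The sets added are indexed by the first compact set and the list of the radii
   used so far. *)
pose it n0 (l : seq nat) := foldr (fun n L => H (L, n)) (K n0) l.
have cit n0 l : compact (it n0 l).
  by elim: l => [|n l IH] /=; [exact: cK|case: (HP (it n0 l, n) IH)].
pose code (k : nat) : nat * seq nat := odflt (0%N, [::]) (unpickle k).
pose A := \bigcup_k it (code k).1 (code k).2.
have inA n0 l x : it n0 l x -> A x.
  by move=> itx; exists (pickle (n0, l)) => //; rewrite /code pickleK.
have haloA n x y : A x -> relatively_compact [set z | d x z < n.+1%:R^-1] ->
    d x y < n.+1%:R^-1 / 2 -> A y.
  move=> [k _ itx] rx xy; apply: (inA (code k).1 (n :: (code k).2)).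
  have [_ /(_ x itx rx)] := HP (it (code k).1 (code k).2, n) (cit _ _).
  exact.
(* The factor 2 leaves room for balls of radius 1/(n+1) at nearby centres. *)
have ball_rc x : exists n, relatively_compact [set y | d x y < n.+1%:R^-1 *+ 2].
  have [U /(dist_nbhsP dX)[e e0 eU] rU] := locally_compact_nbhs x.
  have [n ne] : exists n : nat, n.+1%:R^-1 < e / 2.
    by apply: small_inv; rewrite divr_gt0.
  exists n; apply: relatively_compact_sub rU => y /= xy; apply: eU.
  by apply: (lt_trans xy); move: (n.+1%:R^-1) ne => v ve; rewrite mulr2n; lra.
exists A; split.
- split.
    rewrite openE => x Ax; have [n rn] := ball_rc x.
    apply/(dist_nbhsP dX); exists (n.+1%:R^-1 / 2); first by rewrite divr_gt0.
    move=> y; apply: haloA => //; apply: relatively_compact_sub rn => z /= xz.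
    by rewrite (lt_trans xz)// mulr2n ltrDl.
  move=> y cly; have [n rn] := ball_rc y.
  have n20 : 0 < n.+1%:R^-1 / 2 :> R by rewrite divr_gt0.
  have [x [Ax /= yx]] := cly _ (nbhs_dist_ball dX y n20).
  apply: (haloA n x) => //; last by rewrite (dist_sym dX).
  apply: relatively_compact_sub rn => z /= xz.
  apply: (le_lt_trans (dist_triangle dX x _ _)).
  by move: (n.+1%:R^-1) n20 yx xz => v v0 yx xz; rewrite mulr2n; lra.
- by exists (fun k => it (code k).1 (code k).2).
- by rewrite SK => x [n _ Kx]; apply: (inA n [::]).
Qed.

End zero_dimensional_locally_compact.

(** * Compact layers of a clopen set *)

(** The layers of A are the level sets of i for positive values; level 0 is
reserved for the complement of A, so that i is defined and locally constant on
the whole space. *)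
Record layering (X : topologicalType) (A : set X) (i : X -> nat) : Prop :=
  Layering {
  layer_open : forall x, nbhs x [set y | i y = i x] ;
  layer_outside : forall x, i x = 0%N <-> ~ A x ;
  layers_compact : forall n, relatively_compact [set x | (0 < i x <= n)%N] }.

Section layerings.
Variables (X : topologicalType).
Hypotheses (X0 : has_clopen_base X) (lcX : locally_compact [set: X]).

(** A is a countable union of compact clopen sets C n; a point belongs to layer
n+1 when C n is the first of them to contain it. *)
Lemma sigma_compact_layering (A : set X) : clopen A -> sigma_compact A ->
  exists i, layering A i.
Proof.
move=> [oA cA] [K cK AK].
have /choice[C CP] : forall n, exists C : set X,
    [/\ clopen C, compact C, K n `<=` C & C `<=` A].
  move=> n; apply: compact_clopen_between => //.
  by rewrite AK; exact: bigcup_sup.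
have /choice[i iP] : forall x, exists m : nat, (m = 0%N /\ ~ A x) \/
    exists n, [/\ m = n.+1, C n x & forall k, (k < n)%N -> ~ C k x].
  move=> x; have [Ax|nAx] := pselect (A x); last by exists 0%N; left.
  have Cx : exists n, `[< C n x >].
    move: Ax; rewrite AK => -[n _ Kx]; exists n; apply/asboolP.
    by have [_ _ KC _] := CP n; exact: KC.
  exists (ex_minn Cx).+1; right; exists (ex_minn Cx).
  case: ex_minnP => m /asboolP Cm mmin; split => // k km /asboolP Ck.
  by have := mmin k Ck; rewrite leqNgt km.
have iS x n : C n x -> (forall k, (k < n)%N -> ~ C k x) -> i x = n.+1.
  move=> Cn nC; have [[_ nA]|[m [-> Cm nCm]]] := iP x.
    by case: nA; have [_ _ _ CA] := CP n; exact: CA Cn.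
  by have [mn|nm|->//] := ltngtP m n; [case: (nC m mn)|case: (nCm n nm)].
have i0 x : ~ A x -> i x = 0%N.
  move=> nA; have [[]//|[m [_ Cm _]]] := iP x.
  by case: nA; have [_ _ _ CA] := CP m; exact: CA Cm.
have iA x n : i x = n.+1 -> C n x /\ forall k, (k < n)%N -> ~ C k x.
  by move=> ix; have [[]|[m []]] := iP x; rewrite ix // => -[->].
exists i; split.
- move=> x; case ix : (i x) => [|n].
    have nAx : ~ A x.
      by move=> Ax; have [[_]|[m []]] := iP x; last rewrite ix.
    apply: (@filterS _ (nbhs x) _ (~` A)) => [y /i0 //|].
    by apply: open_nbhs_nbhs; split => //; exact: closed_openC.
  have [Cn nC] := iA _ _ ix.
  have small m : (m <= n)%N -> nbhs x [set y | forall k, (k < m)%N -> ~ C k y].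
    elim: m => [|m IH] mn.
      by apply: (@filterE _ (nbhs x)) => y k.
    apply: (@filterS _ (nbhs x) _
      ([set y | forall k, (k < m)%N -> ~ C k y] `&` ~` C m)).
      move=> y [yk ym] k; rewrite ltnS leq_eqVlt => /orP[/eqP ->//|]; exact: yk.
    apply: filterI; first by apply: IH; exact: ltnW.
    apply: open_nbhs_nbhs; split; last exact: nC.
    by have [[_ ?] _ _ _] := CP m; exact: closed_openC.
  apply: (@filterS _ (nbhs x) _ ([set y | forall k, (k < n)%N -> ~ C k y] `&` C n)).
    by move=> y [yk yn]; exact: iS.
  apply: filterI; first exact: small.
  by apply: open_nbhs_nbhs; split => //; have [[? _] _ _ _] := CP n.
- move=> x; split; last exact: i0.
  by move=> ix Ax; have [[_]|[m []]] := iP x; last rewrite ix.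
- elim=> [|n IH].
    apply: relatively_compact_sub (relatively_compact0 X) => x /= /andP[].
    by rewrite leqn0 lt0n => /negPf ->.
  have rC : relatively_compact (C n) by have [_ ? _ _] := CP n; exists (C n).
  apply: relatively_compact_sub (relatively_compactU IH rC) => x /= /andP[ix].
  rewrite leq_eqVlt => /orP[/eqP/iA[? _]|]; first by right.
  by rewrite ltnS => ixn; left; rewrite ix.
Qed.

Lemma layers_bounded (A : set X) (i : X -> nat) (S : set X) : layering A i ->
  relatively_compact S -> exists N, forall x, S x -> (i x <= N)%N.
Proof.
move=> [li _ _] [K cK SK].
suff [N NK] : exists N, forall x, K x -> (i x <= N)%N.
  by exists N => x /SK; exact: NK.
apply: (@compact_local_ideal _ (fun S => exists N, forall x, S x -> (i x <= N)%N)
  K) => //.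
- by exists 0%N.
- by move=> A' B AB [N NB]; exists N => x /AB; exact: NB.
- move=> A' B [N NA] [M MB]; exists (maxn N M) => x.
  by rewrite leq_max => -[/NA ->//|/MB ->]; rewrite orbT.
- move=> x _; exists [set y | i y = i x]; first exact: li.
  by exists (i x) => y /= ->.
Qed.

(** Each layer is compact, so there the two closed sets are separated by a compact
clopen set; the union over the layers is again clopen because the layers are
locally finite. *)
Lemma clopen_separation (A E F : set X) : clopen A -> sigma_compact A ->
  closed E -> closed F -> E `&` F = set0 ->
  exists B : set X, [/\ clopen B, B `<=` A, A `&` E `<=` B & B `&` F = set0].
Proof.
move=> clA sA cE cF EF; have [i [li i0 ic]] := sigma_compact_layering clA sA.
have [oA cA] := clA.
have cl n : closed [set x | i x = n].
  by move=> x clx; have [y [/= <- /= ->]] := clx _ (li x).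
have op n : open [set x | i x = n] by rewrite openE => x /= <-; exact: li.
have /choice[B BP] : forall n, exists B : set X, [/\ clopen B,
    [set x | i x = n.+1] `&` E `<=` B & B `<=` [set x | i x = n.+1] `&` ~` F].
  move=> n; have [|||B [? _ ? ?]] := @compact_clopen_between _ X0 lcX
      ([set x | i x = n.+1] `&` E) ([set x | i x = n.+1] `&` ~` F).
  - apply: relatively_compact_closed; first exact: closedI.
    by apply: relatively_compact_sub (ic n.+1) => x [/= -> _]; rewrite leqnn.
  - by apply: openI => //; exact: closed_openC.
  - move=> x [ix Ex]; split => // Fx.
    by have : (E `&` F) x by []; rewrite EF.
  - by exists B.
have inA x n : i x = n.+1 -> A x.
  by move=> ix; apply: contrapT => /i0; rewrite ix.
exists (\bigcup_n B n); split.
- split; first by apply: bigcup_open => n _; have [[]] := BP n.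
  move=> x clx; case ix : (i x) => [|n].
    have [y [[n _ Bny] /= iy]] := clx _ (li x).
    by have [_ _ /(_ y Bny)[/= iyn _]] := BP n; rewrite iyn ix in iy.
  exists n => //; have [[_ cB] _ _] := BP n; apply: cB => U nU.
  have [y [[m _ Bmy] [/= iy Uy]]] := clx _ (filterI (li x) nU).
  exists y; split => //; have [_ _ /(_ y Bmy)[/= iym _]] := BP m.
  by move: iy; rewrite iym ix => -[<-].
- by move=> x [n _ Bx]; have [_ _ /(_ x Bx)[/= ix _]] := BP n; exact: inA ix.
- move=> x [Ax Ex]; case ix : (i x) => [|n]; first by case: ((i0 x).1 ix).
  by exists n => //; have [_ EB _] := BP n; apply: EB.
- rewrite -subset0 => x [[n _ Bx] Fx].
  by have [_ _ /(_ x Bx)[_ /=]] := BP n.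
Qed.

End layerings.

(** * Points of the Stone-Cech compactification as filters *)

Section stone_cech_compactification.
Variables (R : realType) (X : topologicalType).
Local Notation beta := (stone_cech R X).
Local Notation emb := (@stone_cech_emb R X).

Definition coordinate (f : continuousType X (unit_itv R)) (p : beta) : R :=
  \val ((\val p : cube R X) f).

Lemma coordinate_continuous f : continuous (coordinate f).
Proof.
move=> p.
apply: (@continuous_comp beta (unit_itv R) R
  (fun q : beta => (\val q : cube R X) f) (fun u => \val u)); last first.
  exact: (@initial_continuous _ _ (@set_val R `[0, 1]%classic)).
apply: (@continuous_comp beta (cube R X) (unit_itv R) (fun q : beta => \val q)
  (fun q : cube R X => q f)).
  exact: (@initial_continuous _ _ (@set_val (cube R X) _)).
exact: (@proj_continuous (continuousType X (unit_itv R)) (fun=> unit_itv R) f).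
Qed.

Lemma coordinate_emb f x : coordinate f (emb x) = \val (f x).
Proof. by []. Qed.

Lemma coordinate_inj p q : (forall f, coordinate f p = coordinate f q) -> p = q.
Proof.
by move=> pq; apply: val_inj; apply: funext => f; apply: val_inj; exact: pq.
Qed.

Lemma stone_cech_emb_continuous : continuous emb.
Proof.
have ce : continuous (@cube_eval R X : X -> cube R X).
  move=> x; apply/cvg_sup => f U [_ [[V oV <-] Vx] VU].
  apply: (@filterS _ (nbhs x) _ (f @^-1` V)); first by move=> y Vy; exact: VU.
  by apply: (@cts_fun _ _ f x); apply: open_nbhs_nbhs; split.
move=> x U [_ [[V oV <-] Vx] VU].
apply: (@filterS _ (nbhs x) _ (@cube_eval R X @^-1` V)).
  by move=> y Vy; exact: VU.
by apply: ce; apply: open_nbhs_nbhs; split.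
Qed.

Lemma stone_cech_emb_dense : dense (range emb).
Proof.
move=> G [p Gp] [V oV VG]; have : (\val p : cube R X) \in closure (range (@cube_eval R X)).
  exact: (valP p).
move/set_mem => /(_ V) [|_ [[x _ <-] Vx]].
  by apply: open_nbhs_nbhs; split => //; move: Gp; rewrite -VG.
by exists (emb x); split; [rewrite -VG|exists x].
Qed.

Lemma stone_cech_compact : compact [set: beta].
Proof.
apply: compact_set_typeT.
apply: (@subclosed_compact _ _ [set: cube R X]) => //.
  exact: closed_closure.
suff -> : [set: cube R X] =
    [set f : forall i : continuousType X (unit_itv R), unit_itv R |
      forall i, [set: unit_itv R] (f i)].
  apply: (@tychonoff _ (fun=> unit_itv R) (fun=> [set: unit_itv R])) => _.
  by apply: compact_set_typeT; exact: segment_compact.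
by apply/seteqP; split.
Qed.

(** The filter on X that converges to p.  For a clopen A, [trace p A] says that p
is in the closure of A, in a form that passes directly to intersections and, by
[trace_clopen], to complements. *)
Definition trace (p : beta) : set (set X) :=
  [set B | exists2 N, nbhs p N & emb @^-1` N `<=` B].

Lemma trace_sub p A B : A `<=` B -> trace p A -> trace p B.
Proof. by move=> AB [N nN NA]; exists N => //; exact: subset_trans AB. Qed.

Lemma traceI p A B : trace p A -> trace p B -> trace p (A `&` B).
Proof.
move=> [N nN NA] [M nM MB]; exists (N `&` M); first exact: filterI.
by move=> x [Nx Mx]; split; [exact: NA|exact: MB].
Qed.

Lemma traceT p : trace p [set: X].
Proof. by exists [set: beta] => //; exact: filterT. Qed.

Lemma trace_nonempty p A : trace p A -> A !=set0.
Proof.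
move=> [N]; rewrite nbhsE => -[G [oG Gp] GN] NA.
have [|q [Gx [x _ ex]]] := stone_cech_emb_dense _ oG; first by exists p.
by exists x; apply: NA; apply: GN; rewrite /= ex.
Qed.

Lemma traceC p A : trace p A -> ~ trace p (~` A).
Proof.
by move=> tA tnA; have [x []] := trace_nonempty (traceI tA tnA).
Qed.

Lemma trace_preimage p N : nbhs p N -> trace p (emb @^-1` N).
Proof. by exists N. Qed.

Lemma trace_open A : open [set p | trace p A].
Proof.
rewrite openE => p [N /nbhs_interior nN NA].
apply: (@filterS _ (nbhs p)) nN => q nNq; by exists N.
Qed.

Lemma trace_emb x A : trace (emb x) A -> nbhs x A.
Proof.
move=> [N nN NA]; apply: (@filterS _ (nbhs x)) NA _.
exact: stone_cech_emb_continuous.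
Qed.

Lemma indicator_coordinate (A : set X) : clopen A ->
  exists f : continuousType X (unit_itv R),
    forall x, (A x -> \val (f x) = 1) /\ (~ A x -> \val (f x) = 0).
Proof.
move=> [oA cA].
have i0 : (0 : R) \in `[0, 1]%classic by apply/mem_set; rewrite /= in_itv/= lexx ler01.
have i1 : (1 : R) \in `[0, 1]%classic by apply/mem_set; rewrite /= in_itv/= lexx ler01.
pose g (x : X) : unit_itv R :=
  if `[< A x >] then exist _ 1 i1 else exist _ 0 i0.
have cg : continuous g.
  move=> x U nU; have nUx := nbhs_singleton nU.
  have [Ax|nAx] := pselect (A x).
    have nA : nbhs x A by apply: open_nbhs_nbhs; split.
    apply: (@filterS _ (nbhs x)) nA => y Ay /=.
    by move: nUx; rewrite /g !asboolT.
  have nA : nbhs x (~` A).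
    by apply: open_nbhs_nbhs; split => //; exact: closed_openC.
  apply: (@filterS _ (nbhs x)) nA => y Ay /=.
  by move: nUx; rewrite /g !asboolF.
exists (mkcts cg) => x; change ((A x -> \val (g x) = 1) /\ (~ A x -> \val (g x) = 0)).
by rewrite /g; split=> Ax; [rewrite asboolT|rewrite asboolF].
Qed.

(** The indicator function of A is one of the coordinates of the cube, and near p
this coordinate varies by less than 1, so it does not take both values 0 and 1
there. *)
Lemma trace_clopen p A : clopen A -> trace p A \/ trace p (~` A).
Proof.
move=> /indicator_coordinate[f fP].
have h0 : 0 < 2^-1 :> R by rewrite invr_gt0.
pose N := [set q | `|coordinate f p - coordinate f q| < 2^-1].
have nN : nbhs p N.
  exact: (coordinate_continuous (nbhsx_ballx (coordinate f p) _ h0)).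
have [[x [Ax Nx]]|nA] := pselect (exists x, A x /\ N (emb x)); last first.
  by right; exists N => // x Nx Ax; apply: nA; exists x.
left; exists N => // y Ny; apply: contrapT => nAy.
move: Nx Ny; rewrite /N /= !coordinate_emb.
rewrite (fP x).1// (fP y).2//.
move: (coordinate f p) => c; rewrite !ltr_norml => /andP[? ?] /andP[? ?]; lra.
Qed.

Lemma clopen_trace A : clopen A -> clopen [set p | trace p A].
Proof.
move=> cA; split; first exact: trace_open.
rewrite -openC; suff -> : ~` [set p | trace p A] = [set p | trace p (~` A)].
  exact: trace_open.
apply/seteqP; split=> p /= tA; first by case: (trace_clopen p cA).
by move=> /traceC.
Qed.

(** Distinct points have distinct coordinates for some f; inverse images under f
of small closed balls around the two values separate them. *)
Lemma trace_separation p q : p <> q -> exists E F : set X,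
  [/\ closed E, closed F, E `&` F = set0, trace p E & trace q F].
Proof.
move=> pq; have [f fpq] : exists f, coordinate f p <> coordinate f q.
  apply: contrapT => nf; apply: pq; apply: coordinate_inj => f.
  by apply: contrapT => fpq; apply: nf; exists f.
have cf : continuous (fun x => \val (f x) : R).
  move=> x; apply: (@continuous_comp X (unit_itv R) R f (fun u => \val u)).
    exact: cts_fun.
  exact: (@initial_continuous _ _ (@set_val R `[0, 1]%classic)).
pose r := `|coordinate f p - coordinate f q| / 3.
have r0 : 0 < r by rewrite divr_gt0// normr_gt0 subr_eq0; apply/eqP.
have cE c : closed [set x | `|c - \val (f x)| <= r].
  apply: (@preimage_closed _ _ (fun x => `|c - \val (f x)|) [set y | y <= r]).
    move=> x _; apply: cvg_norm; apply: cvgB; [exact: cvg_cst|exact: cf].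
  exact: closed_le.
have tE s : trace s [set x | `|coordinate f s - \val (f x)| <= r].
  have nN : nbhs s [set t | `|coordinate f s - coordinate f t| < r].
    exact: (coordinate_continuous (nbhsx_ballx (coordinate f s) _ r0)).
  by apply: trace_sub (trace_preimage nN) => x /ltW.
exists [set x | `|coordinate f p - \val (f x)| <= r].
exists [set x | `|coordinate f q - \val (f x)| <= r]; split => //.
rewrite -subset0 => x [/= px qx].
have := ler_distD (\val (f x)) (coordinate f p) (coordinate f q).
rewrite [`|\val (f x) - _|]distrC.
by move: r0 px qx; rewrite /r => ? ? ?; lra.
Qed.

Lemma trace_compact p K : compact K -> trace p K -> range emb p.
Proof.
move=> cK tK; apply: contrapT => np.
suff tnK : trace p (~` K) by exact: traceC tnK.
apply: (@compact_local_ideal _ (fun S => trace p (~` S)) K) => //.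
- by rewrite setC0; exact: traceT.
- by move=> A B AB; apply: trace_sub; exact: subsetC.
- by move=> A B tA tB; rewrite setCU; exact: traceI.
- move=> x _; have [|E [F [_ _ EF tE /trace_emb nF]]] := @trace_separation p (emb x).
    by move=> px; apply: np; rewrite px; exists x.
  by exists F => //; apply: trace_sub tE; exact/disjoints_subset.
Qed.

Lemma trace_closure p A : clopen A -> trace p A <-> closure (emb @` A) p.
Proof.
move=> clA; split=> [tA N nN|clp].
  have [x [Ax Nx]] := trace_nonempty (traceI tA (trace_preimage nN)).
  by exists (emb x); split => //; exists x.
have [//|[N nN NA]] := trace_clopen p clA.
by have [_ [[x Ax <-] /NA]] := clp N nN.
Qed.

Section locally_compact_zero_dimensional.
Hypotheses (X0 : has_clopen_base X) (lcX : locally_compact [set: X]).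

Lemma emb_nbhs_trace x U : nbhs x U -> trace (emb x) U.
Proof.
move=> nU; have [C [clC _ Cx CU]] := compact_clopen_nbhs X0 lcX nU.
apply: (trace_sub CU); have [//|/trace_emb/nbhs_singleton] := trace_clopen (emb x) clC.
by [].
Qed.

Lemma stone_cech_emb_open : open (range emb).
Proof.
rewrite openE => _ [x _ <-].
have [C [clC cC Cx _]] := compact_clopen_nbhs X0 lcX (@filterT _ (nbhs x) _).
have tC : trace (emb x) C.
  by apply: emb_nbhs_trace; apply: open_nbhs_nbhs; split => //; case: clC.
have nC : nbhs (emb x) [set p | trace p C].
  by apply: open_nbhs_nbhs; split => //; exact: trace_open.
by apply: (@filterS _ (nbhs (emb x))) nC => p; exact: trace_compact.
Qed.

Lemma trace_relatively_compact p A :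
  clopen A -> relatively_compact A -> trace p A -> range emb p.
Proof.
move=> [_ cA] rA; apply: trace_compact; exact: relatively_compact_closed.
Qed.

(** The sets that contain A up to a relatively compact set form a proper filter;
its image clusters in the compactification, and no point of X is a cluster point
because it has a compact neighbourhood. *)
Lemma trace_exists A : clopen A -> ~ relatively_compact A ->
  exists2 p, ~ range emb p & trace p A.
Proof.
move=> clA nrA; pose F : set_system beta :=
  [set N | relatively_compact (A `\` emb @^-1` N)].
have FF : ProperFilter F.
  split; first by rewrite /F /= preimage_set0 setD0.
  split.
  - by rewrite /F /= preimage_setT setDT; exact: relatively_compact0.
  - move=> N M FN FM; rewrite /F /= preimage_setI setDIr.
    exact: relatively_compactU.
  - move=> N M NM; apply: relatively_compact_sub => x [Ax nM].
    by split => // /NM.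
have [p [_ clp]] := stone_cech_compact FF filterT.
have FA S : relatively_compact (A `\` S) -> F (emb @` S).
  by apply: relatively_compact_sub => x [Ax nS]; split => // Sx; apply: nS; exists x.
exists p.
  move=> [x _ px]; have [C [clC cC Cx _]] :=
    compact_clopen_nbhs X0 lcX (@filterT _ (nbhs x) _).
  have [|N nN NC] := @emb_nbhs_trace x C.
    by apply: open_nbhs_nbhs; split => //; case: clC.
  have FC : F (emb @` (~` C)).
    by apply: FA; rewrite setDE setCK; exists C.
  by rewrite -px in clp; have [_ [[y nC <-] /NC]] := clp _ _ FC nN.
have [//|[N nN NA]] := trace_clopen p clA.
have FAA : F (emb @` A) by apply: FA; rewrite setDv; exact: relatively_compact0.
by have [_ [[x Ax <-] /NA]] := clp _ _ FAA nN.
Qed.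

End locally_compact_zero_dimensional.

End stone_cech_compactification.

(** * Clopen sets of the remainder *)

Section remainder.
Variables (R : realType) (X : topologicalType).
Local Notation beta := (stone_cech R X).
Local Notation emb := (@stone_cech_emb R X).
Local Notation remainder := (omega_sigma_remainder R X).

Lemma sigma_set_trace (A : set X) (p : beta) :
  clopen A -> sigma_compact A -> trace p A -> sigma_set p.
Proof. by move=> clA sA /(trace_closure p clA) clp; exists A. Qed.

(** The part of the remainder in the closure of A, for clopen A; the added point
at infinity of the one-point compactification never belongs to it. *)
Definition ends (A : set X) : set remainder :=
  [set z | exists2 s : sigma_space R X, \val z = Some s & trace (\val s) A].

Section sigma_compact_clopen.
Variables (A : set X).
Hypotheses (clA : clopen A) (sA : sigma_compact A).

Let S : set (sigma_space R X) := [set s | trace (\val s) A].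

Let clopen_S : clopen S.
Proof.
have [oT cT] := clopen_trace R clA.
have cv : continuous (fun s : sigma_space R X => \val s : beta).
  exact: (@initial_continuous _ _ (@set_val beta _)).
split; first by move/continuousP: cv => /(_ _ oT).
exact: (@preimage_closed _ _ (fun s : sigma_space R X => \val s : beta) _ _ cT).
Qed.

Let compact_S : compact S.
Proof.
apply: compact_set_type.
have [_ cT] := clopen_trace R clA.
suff -> : set_val @` S = [set p | trace p A].
  exact: subclosed_compact cT (@stone_cech_compact R X) _.
apply/seteqP; split=> [_ [s tA <-] //|p tA].
by exists (exist _ p (mem_set (sigma_set_trace clA sA tA))).
Qed.

(** Openness of the complement at the point at infinity is the compactness of the
closure of A, which is contained in the sigma-compact closure of X. *)
Lemma ends_clopen : clopen (ends A).
Proof.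
have [oS cS] := clopen_S.
have cv : continuous (fun z : remainder => \val z : omega_sigma R X).
  exact: (@initial_continuous _ _ (@set_val (omega_sigma R X) _)).
have endsE : ends A = (fun z : remainder => \val z : omega_sigma R X) @^-1`
    (Some @` S).
  by apply/seteqP; split=> z [s] => [zs tA|tA zs]; exists s.
split.
  rewrite endsE; move/continuousP: cv; apply.
  exact: one_point_compactification_open_some.
rewrite endsE; apply: preimage_closed => [z _|]; first exact: cv.
rewrite -openC openE => -[s|] nS.
  have nSs : nbhs s (~` S).
    apply: open_nbhs_nbhs; split; first exact: closed_openC.
    by move=> Ss; apply: nS; exists s.
  by apply: (@filterS _ (nbhs s)) nSs => t nSt [u Su [ut]]; apply: nSt; rewrite -ut.
exists S; first by split.
by move=> _ [[t nSt <-] [u Su [ut]]|-> []//]; apply: nSt; rewrite -ut.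
Qed.

End sigma_compact_clopen.

Hypotheses (X0 : has_clopen_base X) (lcX : locally_compact [set: X]).

(** X is open in its Stone-Cech compactification, hence in the one-point
compactification, so the remainder is closed there. *)
Lemma remainder_compact : compact [set: remainder].
Proof.
apply: compact_set_typeT.
apply: (@subclosed_compact _ _ [set: omega_sigma R X]) => //; last first.
  exact: one_point_compactification_compact.
apply: open_closedC.
have -> : range (@omega_sigma_emb R X) = Some @` range (@sigma_emb R X).
  apply/seteqP; split=> [_ [x _ <-]|_ [_ [x _ <-] <-]]; last by exists x.
  by exists (sigma_emb R x) => //; exists x.
apply: one_point_compactification_open_some.
have cv : continuous (fun s : sigma_space R X => \val s : beta).
  exact: (@initial_continuous _ _ (@set_val beta _)).
have -> : range (@sigma_emb R X) = (fun s : sigma_space R X => \val s) @^-1`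
    range emb.
  apply/seteqP; split=> [_ [x _ <-]|s [x _ xs]]; first by exists x.
  by exists x => //; apply: val_inj.
by move/continuousP: cv; apply; exact: stone_cech_emb_open.
Qed.

Lemma remainder_notin (z : remainder) (s : sigma_space R X) :
  \val z = Some s -> ~ range emb (\val s).
Proof.
move=> zs [x _ xs]; have /set_mem := valP z; apply.
exists x => //; rewrite zs; congr Some; exact: val_inj.
Qed.

Lemma ends_not_relatively_compact A z :
  clopen A -> ends A z -> ~ relatively_compact A.
Proof.
move=> clA [s zs tA] rA; apply: (remainder_notin zs).
exact: trace_relatively_compact tA.
Qed.

Lemma endsI A B z : ends A z -> ends B z -> ends (A `&` B) z.
Proof.
move=> [s zs tA] [t zt tB]; exists s => //; apply: traceI => //.
by move: zt; rewrite zs => -[->].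
Qed.

Lemma ends_split A B z : clopen B -> ends A z -> ends B z \/ ends (A `\` B) z.
Proof.
move=> clB [s zs tA]; have [tB|tnB] := trace_clopen (\val s) clB.
  by left; exists s.
by right; exists s => //; exact: traceI.
Qed.

Lemma ends_le A B z : clopen A -> clopen B -> relatively_compact (A `\` B) ->
  ends A z -> ends B z.
Proof.
move=> clA clB rAB hA; have [//|hAB] := ends_split clB hA.
exfalso; apply: ends_not_relatively_compact hAB rAB.
by rewrite setDE; apply: clopenI => //; exact: clopenC.
Qed.

Lemma ends_nonempty A : clopen A -> sigma_compact A -> ~ relatively_compact A ->
  exists z, ends A z.
Proof.
move=> clA sA /(trace_exists R X0 lcX clA)[p np tA].
have sp := sigma_set_trace clA sA tA.
pose s : sigma_space R X := exist _ p (mem_set sp).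
have nr : (~` range (@omega_sigma_emb R X)) (Some s).
  by move=> [x _ [xs]]; apply: np; exists x.
by exists (exist _ (Some s) (mem_set nr)), s.
Qed.

Lemma sigma_trace (s : sigma_space R X) : metrizable R X ->
  exists A : set X, [/\ clopen A, sigma_compact A & trace (\val s) A].
Proof.
move=> mX; have /set_mem[S sS clp] := valP s.
have [A [clA sA SA]] := sigma_compact_hull lcX mX sS.
exists A; split => //; apply/(trace_closure _ clA).
by apply: closureS clp; exact: image_subset.
Qed.

(** The point at infinity is separated from any other by every A with that other
point in its closure.  For two other points, one such A is first cut down
by a clopen set separating two closed members of their filters. *)
Lemma ends_separates (z w : remainder) : metrizable R X -> z <> w ->
  exists A : set X, [/\ clopen A, sigma_compact A & ~ (ends A z <-> ends A w)].
Proof.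
move=> mX; case ez : (\val z) => [s|]; case ew : (\val w) => [t|] zw.
- have [A [clA sA tA]] := sigma_trace s mX.
  have [|E [F [cE cF EF tE tF]]] := @trace_separation R X (\val s) (\val t).
    by move=> /val_inj st; apply: zw; apply: val_inj; rewrite /= ez ew st.
  have [B [clB BA AEB BF]] := clopen_separation X0 lcX clA sA cE cF EF.
  exists B; split => //; first by apply: sigma_compact_subclosed sA => //; case: clB.
  move=> [hzw _]; have [|t'] := hzw.
    by exists s => //; apply: trace_sub AEB _; exact: traceI.
  rewrite ew => -[<-] tB; have := trace_nonempty (traceI tB tF).
  by rewrite BF => -[].
- have [A [clA sA tA]] := sigma_trace s mX; exists A; split => // -[hzw _].
  by have [|t] := hzw; [exists s|rewrite ew].
- have [A [clA sA tA]] := sigma_trace t mX; exists A; split => // -[_ hwz].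
  by have [|s] := hwz; [exists t|rewrite ez].
- by case: zw; apply: val_inj; rewrite /= ez ew.
Qed.

End remainder.

(** * Neighbourhoods of the point of an extension *)

Section extension_points.
Variables (R : realType) (X : topologicalType) (e : one_point_extension R X).
Local Notation emb := (ext_emb e).
Local Notation pt := (ext_pt e).

Lemma ext_hausdorff : hausdorff_space e.
Proof.
by have [d /distance_hausdorff] := metrizable_distance (ext_metrizable e).
Qed.

Lemma ext_emb_neq x : emb x <> pt.
Proof.
have : range emb (emb x) by exists x.
by rewrite ext_emb_range.
Qed.

Lemma ext_cases y : y = pt \/ exists x, y = emb x.
Proof.
have [->|yp] := pselect (y = pt); first by left.
have : range emb y by rewrite ext_emb_range.
by move=> [x _ <-]; right; exists x.
Qed.

Lemma ext_range_open : open (range emb).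
Proof.
rewrite ext_emb_range openC; apply: accessible_closed_set1.
exact/hausdorff_accessible/ext_hausdorff.
Qed.

Lemma ext_nbhs_emb x (V : set e) : nbhs (emb x) V <-> nbhs x (emb @^-1` V).
Proof.
rewrite nbhsE nbhsE; split=> [[W [oW Wx] WV]|].
  exists (emb @^-1` W); last by move=> y Wy; exact: WV.
  by split => //; apply/ext_emb_open; exists W.
move=> [U [oU Ux] UV]; have [W oW UW] := (ext_emb_open e U).1 oU.
rewrite {}UW in Ux UV; exists (W `&` range emb).
  split; last by split => //; exists x.
  by apply: openI => //; exact: ext_range_open.
by move=> y [Wy [z _ zy]]; move: Wy; rewrite -zy; exact: UV.
Qed.

Lemma ext_emb_continuous : continuous emb.
Proof. by move=> x V /ext_nbhs_emb. Qed.

Lemma ext_compact_preimage (K : set e) : compact K -> K `<=` range emb ->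
  compact (emb @^-1` K).
Proof.
move=> cK KX; apply: (compact_preimage_image (f := emb)).
  move=> x U nU; exists (emb @` U); last first.
    by move=> y [z Uz /ext_emb_inj <-].
  by apply/ext_nbhs_emb; apply: (@filterS _ (nbhs x)) nU => y Uy; exists y.
suff -> : emb @` (emb @^-1` K) = K by [].
apply/seteqP; split=> [_ [x Kx <-] //|y Ky].
by have [x _ xy] := KX y Ky; exists x; rewrite /= xy.
Qed.

Lemma ext_compact_image (K : set X) : compact K -> compact (emb @` K).
Proof.
by move=> cK; apply: continuous_compact => //; exact/continuous_subspaceT/ext_emb_continuous.
Qed.

Lemma ext_image_closed (K : set X) : compact K -> closed (emb @` K).
Proof.
by move=> cK; apply: compact_closed; [exact: ext_hausdorff|exact: ext_compact_image].
Qed.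

Definition punctured (U : set X) : set e := emb @` U `|` [set pt].

Lemma punctured_emb U x : punctured U (emb x) <-> U x.
Proof.
split=> [[[y Uy /ext_emb_inj <-] //|/ext_emb_neq[]]|Ux].
by left; exists x.
Qed.

Lemma nbhs_punctured (N : set e) :
  nbhs pt N <-> N pt /\ nbhs pt (punctured (emb @^-1` N)).
Proof.
split=> [nN|[Np]].
  split; first exact: nbhs_singleton.
  apply: (@filterS _ (nbhs pt)) nN => y; have [->|[x ->]] := ext_cases y.
    by move=> _; right.
  by move=> Nx; apply/punctured_emb.
apply: (@filterS _ (nbhs pt)) => _ [[x Nx <-] //|-> //].
Qed.

(** The point of the extension is the limit of A modulo relatively compact
sets. *)
Definition represents (A : set X) : Prop :=
  forall U : set X, nbhs pt (punctured U) <-> relatively_compact (A `\` U).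

Lemma represents_not_relatively_compact A :
  represents A -> ~ relatively_compact A.
Proof.
move=> rep rA; have : nbhs pt (punctured set0) by apply/rep; rewrite setD0.
rewrite nbhsE => -[G [oG Gp] GN].
have [|y [Gy [x _ xy]]] := @ext_dense _ _ e G _ oG; first by exists pt.
have := GN _ Gy; rewrite -xy => /punctured_emb.
by [].
Qed.

(** The point together with A is a compact neighbourhood of the point: a filter on
it that does not cluster at the point lives on A minus a neighbourhood of the
point, which is relatively compact in X. *)
Lemma represents_locally_compact A : locally_compact [set: X] ->
  closed A -> represents A -> locally_compact [set: e].
Proof.
move=> lcX cA rep y _.
suff [U nU cU] : exists2 U, nbhs y U & compact U.
  exists U; first by apply: (@filterS _ (nbhs y)) nU.
  by split => //; apply: compact_closed => //; exact: ext_hausdorff.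
have [->|[x ->]] := ext_cases y; last first.
  have [U nU [K cK UK]] := locally_compact_nbhs lcX x.
  exists (emb @` K); last exact: ext_compact_image.
  apply/ext_nbhs_emb; apply: (@filterS _ (nbhs x)) nU => z /UK Kz.
  by exists z.
exists (punctured A).
  by apply/rep; rewrite setDv; exact: relatively_compact0.
move=> F FF FA; have [clp|] := pselect (cluster F pt).
  by exists pt; split => //; right.
move=> /existsNP[B] /existsNP[N] /not_implyP[FB] /not_implyP[nN] BN.
have [Np /rep[K cK AK]] := (nbhs_punctured N).1 nN.
have FK : F (emb @` (K `&` A)).
  apply: (filterS _ (filterI FA FB)) => z [[[x Ax <-] Bx|-> Bp]].
    exists x => //; split => //; apply: AK; split => // Nx; apply: BN.
    by exists (emb x).
  by exfalso; apply: BN; exists pt.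
have [z [[x [_ Ax] <-] clz]] := ext_compact_image (compact_closedI cK cA) FF FK.
by exists (emb x); split => //; apply/punctured_emb.
Qed.

End extension_points.

(** * The order of extensions and admissible sets *)

Section extension_order.
Variables (R : realType) (X : topologicalType).
Implicit Types e : one_point_extension R X.

Lemma ext_le_trans e1 e2 e3 : ext_le e1 e2 -> ext_le e2 e3 -> ext_le e1 e3.
Proof.
move=> [f cf fE] [g cg gE]; exists (f \o g); last by move=> x /=; rewrite gE.
by move=> y; apply: continuous_comp; [exact: cg|exact: cf].
Qed.

Lemma ext_equiv_le e1 e2 : ext_equiv e1 e2 -> ext_le e1 e2 /\ ext_le e2 e1.
Proof.
move=> [h [ch [g [cg hK gK]]] hE]; split; last by exists h.
by exists g => // x; rewrite -hE hK.
Qed.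

(** If the point were mapped to some x in X, then points of X near it in e2 would
also be near x, as f fixes them, contradicting that e2 is Hausdorff. *)
Lemma ext_map_pt e1 e2 (f : e2 -> e1) : continuous f ->
  (forall x, f (ext_emb e2 x) = ext_emb e1 x) -> f (ext_pt e2) = ext_pt e1.
Proof.
move=> cf fE; have [//|[x fx]] := ext_cases (f (ext_pt e2)).
exfalso; apply: (@ext_emb_neq _ _ e2 x); apply: (@ext_hausdorff _ _ e2) => U V.
move=> /ext_nbhs_emb nU nV.
have nfU : nbhs (ext_pt e2) (f @^-1` (ext_emb e1 @` (ext_emb e2 @^-1` U))).
  apply: cf; rewrite fx; apply/ext_nbhs_emb; apply: (@filterS _ (nbhs x)) nU => y Uy.
  by exists y.
have : nbhs (ext_pt e2)
    (f @^-1` (ext_emb e1 @` (ext_emb e2 @^-1` U)) `&` V) by exact: filterI.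
rewrite nbhsE.
move=> [G [oG Gp] GUV].
have [|w [Gw [y _ yw]]] := @ext_dense _ _ e2 G _ oG; first by exists (ext_pt e2).
have [[z Uz zw] Vw] := GUV _ Gw.
have zy : z = y by apply: (@ext_emb_inj _ _ e1); rewrite zw -yw fE.
by exists (ext_emb e2 y); split; [rewrite -zy|rewrite yw].
Qed.

(** Given a morphism, the preimage of the neighbourhood of the first point cut out
by A1 is a neighbourhood of the second, which gives the comparison of A2 with
A1.  Given the comparison, the map fixing X and sending point to point is
continuous. *)
Lemma ext_le_represents e1 e2 (A1 A2 : set X) :
  represents e1 A1 -> represents e2 A2 ->
  ext_le e1 e2 <-> relatively_compact (A2 `\` A1).
Proof.
move=> r1 r2; split=> [[f cf fE]|r21].
  apply/r2; apply/(nbhs_punctured _).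
  have nf : nbhs (ext_pt e2) (f @^-1` (@punctured _ _ e1 A1)).
    apply: (cf); rewrite (ext_map_pt cf fE); apply/r1; rewrite setDv.
    exact: relatively_compact0.
  split; first by right.
  apply: (@filterS _ (nbhs (ext_pt e2))) nf => y.
  have [->|[x ->]] := ext_cases y; first by move=> _; right.
  by rewrite /= fE => /punctured_emb Ax; do 2 apply/punctured_emb.
have /choice[f fP] : forall y : e2, exists z : e1,
    (y = ext_pt e2 -> z = ext_pt e1) /\
    forall x, y = ext_emb e2 x -> z = ext_emb e1 x.
  move=> y; have [->|[x ->]] := ext_cases y.
    by exists (ext_pt e1); split => // x /esym/ext_emb_neq.
  exists (ext_emb e1 x); split; first by move=> /ext_emb_neq.
  by move=> z /ext_emb_inj ->.
have fpt : f (ext_pt e2) = ext_pt e1 by exact: (fP _).1.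
have fE x : f (ext_emb e2 x) = ext_emb e1 x by exact: (fP _).2.
exists f => // y N; have [->|[x ->]] := ext_cases y; last first.
  rewrite fE => /ext_nbhs_emb nN; rewrite nbhs_simpl/=; apply/ext_nbhs_emb.
  by apply: (@filterS _ (nbhs x)) nN => z /=; rewrite fE.
rewrite fpt => /nbhs_punctured[Np /r1 rN]; rewrite nbhs_simpl/=.
apply/nbhs_punctured; split; first by rewrite /= fpt.
apply/r2; apply: relatively_compact_sub (relatively_compactU r21 rN).
move=> x [A2x]; rewrite /preimage/= fE => nN.
by have [A1x|nA1x] := pselect (A1 x); [right|left].
Qed.

Definition admissible (A : set X) : Prop :=
  [/\ clopen A, sigma_compact A & ~ relatively_compact A].

(** Let K be a compact neighbourhood of the point.  Its boundary is a compact
subset of X, covered by some compact clopen C; then K minus C is clopen, and A is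
its trace on X.  A is sigma-compact because its parts at distance at least 1/(n+1)
from the point are compact. *)
Lemma locally_compact_represented e : has_clopen_base X ->
  locally_compact [set: X] -> locally_compact [set: e] ->
  exists2 A : set X, admissible A & represents e A.
Proof.
move=> X0 lcX lce; have [K nK [cK clK]] := lce (ext_pt e) I.
have {}nK : nbhs (ext_pt e) K.
  by apply: (@filterS _ (nbhs (ext_pt e)) _ _ _ _ nK) => y; exact.
pose emb := ext_emb e.
have cpre (L : set e) : closed L -> L `<=` K -> ~ L (ext_pt e) ->
    compact (emb @^-1` L).
  move=> cL LK Lp; apply: ext_compact_preimage.
    exact: subclosed_compact cL cK LK.
  by move=> y Ly; rewrite ext_emb_range => yp; apply: Lp; rewrite -yp.
have cbd : compact (emb @^-1` (K `\` K°)).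
  apply: cpre; last by move=> [_]; apply.
    by apply: closedI => //; apply: open_closedC; exact: open_interior.
  by move=> y [].
have [C [[oC clC] cC KC _]] := compact_clopen_between X0 lcX cbd openT (@subsetT _ _).
pose A := emb @^-1` K `\` C.
have cA : closed A.
  apply: closedI; last exact: open_closedC.
  by apply: preimage_closed => // x _; exact: ext_emb_continuous.
have oA : open A.
  rewrite openE => x [Kx nCx]; apply: filterI; last first.
    by apply: open_nbhs_nbhs; split => //; exact: closed_openC.
  apply/ext_nbhs_emb; apply: contrapT => nKx; apply: nCx; apply: KC.
  by split.
have repA : represents e A.
  move=> U; split=> [|[L cL AL]].
    rewrite nbhsE => -[G [oG Gp] GU].
    have cG : compact (emb @^-1` (K `\` G)).
      apply: cpre; [|exact: subDsetl|by move=> []].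
      by apply: closedI => //; exact: open_closedC.
    rewrite setDE; exists (emb @^-1` (K `\` G)) => //.
    move=> x [[Kx nCx] nUx]; split => // /GU/punctured_emb; exact: nUx.
  have nN : nbhs (ext_pt e) (K `&` ~` (emb @` (L `|` C))).
    apply: filterI => //; apply: open_nbhs_nbhs; split.
      by apply: closed_openC; apply: ext_image_closed; exact: compactU.
    by move=> [x _ /ext_emb_neq].
  apply: (@filterS _ (nbhs (ext_pt e))) nN => y [Ky nLC].
  have [->|[x yx]] := ext_cases y; first by right.
  rewrite yx in Ky nLC *; apply/punctured_emb; apply: contrapT => nUx.
  have [Cx|nCx] := pselect (C x); first by apply: nLC; exists x => //; right.
  by apply: nLC; exists x => //; left; apply: AL; split.
exists A => //; split => //; last exact: represents_not_relatively_compact repA.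
have [d dE] := metrizable_distance (ext_metrizable e).
pose far n : set e := [set y | n.+1%:R^-1 <= d (ext_pt e) y].
have cfar n : closed (far n).
  rewrite -openC openE => y /negP; rewrite -real_ltNge ?num_real// => yn.
  apply/(dist_nbhsP dE); exists (n.+1%:R^-1 - d (ext_pt e) y); rewrite ?subr_gt0//.
  move=> z yz; apply/negP; rewrite -ltNge.
  by apply: (le_lt_trans (dist_triangle dE y _ _)); rewrite -ltrBrDl.
exists (fun n => emb @^-1` (K `&` far n) `&` ~` C).
  move=> n; apply: compact_closedI; last exact: open_closedC.
  apply: cpre; [exact: closedI|by move=> y []|].
  move=> [_]; rewrite /far/= (dist_xx dE) leNgt => /negP; apply.
  by rewrite invr_gt0.
apply/seteqP; split=> [x [Kx nCx]|x [n _ [[Kx _] nCx]]]; last by split.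
have [|n nx] := @small_inv R (d (ext_pt e) (emb x)).
  rewrite lt_neqAle (dist_ge0 dE) andbT; apply/eqP => /esym/(dist_eq0 dE)/esym.
  exact: ext_emb_neq.
by exists n => //; split => //; split => //; exact: ltW.
Qed.

End extension_order.

(** * The extension determined by an admissible set *)

Section layered_space.
Variables (R : realType) (X : topologicalType) (d : X -> X -> R) (i : X -> nat).
Hypothesis dX : compatible_distance d.

(** X with a point [None] to which the layers of i converge: points in the same
layer n keep their distance, truncated at the radius 1/(n+1), and points in
different layers are as far apart as the larger radius.  The point is a layer of
its own, of radius 0.  As layer 0 has radius 1, it stays away from the point. *)
Definition layered_space of compatible_distance d & (X -> nat) : Type := option X.
Local Notation L := (layered_space dX i).

HB.instance Definition _ := Choice.copy L (option X).

Definition radius (u : L) : R := if u is Some x then (i x).+1%:R^-1 else 0.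

Definition within_layer (u v : L) : R :=
  if (u, v) is (Some x, Some y) then d x y else 0.

Definition layer (u : L) : option nat := omap i u.

Definition layered_dist (u v : L) : R :=
  if layer u == layer v then Num.min (within_layer u v) (radius u)
  else Num.max (radius u) (radius v).

Lemma radius_ge0 u : 0 <= radius u.
Proof. by case: u => //= x; rewrite invr_ge0. Qed.

Lemma radius_eq0 u : radius u = 0 -> u = None.
Proof. by case: u => //= x /eqP; rewrite invr_eq0 pnatr_eq0. Qed.

Lemma layer_radius u v : layer u = layer v -> radius u = radius v.
Proof. by case: u v => [x|] [y|] //= [->]. Qed.

Lemma within_layer_ge0 u v : 0 <= within_layer u v.
Proof. by case: u v => [x|] [y|] //=; exact: dist_ge0. Qed.

Lemma within_layer_sym u v : within_layer u v = within_layer v u.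
Proof. by case: u v => [x|] [y|] //=; exact: dist_sym. Qed.

Lemma within_layer_triangle u v w : layer u = layer v -> layer v = layer w ->
  within_layer u w <= within_layer u v + within_layer v w.
Proof.
case: u v w => [x|] [y|] [z|] //= _ _; last by rewrite addr0.
exact: dist_triangle.
Qed.

Lemma layered_dist_xx u : layered_dist u u = 0.
Proof.
rewrite /layered_dist eqxx; have -> : within_layer u u = 0.
  by case: u => //= x; exact: dist_xx.
by apply/min_idPl; exact: radius_ge0.
Qed.

Lemma layered_dist_sym u v : layered_dist u v = layered_dist v u.
Proof.
rewrite /layered_dist [layer v == _]eq_sym; case: eqP => [uv|_]; last exact: maxC.
by rewrite within_layer_sym (layer_radius uv).
Qed.

Lemma layered_dist_eq0 u v : layered_dist u v = 0 -> u = v.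
Proof.
rewrite /layered_dist; case: eqP => [uv|nuv] d0.
  have [/radius_eq0 u0|ru] := eqVneq (radius u) 0.
    by move: uv; rewrite u0; case: v {d0}.
  have ru0 : 0 < radius u by rewrite lt_neqAle eq_sym ru radius_ge0.
  have w0 : within_layer u v = 0.
    by move: d0; rewrite minEle; case: ifP => // _ r0; rewrite r0 eqxx in ru.
  case: u v uv w0 ru {d0 ru0} => [x|] [y|] //= _ w0 _.
  by rewrite (dist_eq0 dX w0).
have u0 : radius u = 0.
  by apply/eqP; rewrite eq_le radius_ge0 andbT -d0 le_max lexx.
have v0 : radius v = 0.
  by apply/eqP; rewrite eq_le radius_ge0 andbT -d0 le_max lexx orbT.
by case: nuv; rewrite (radius_eq0 u0) (radius_eq0 v0).
Qed.

Lemma layered_dist_triangle v u w :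
  layered_dist u w <= layered_dist u v + layered_dist v w.
Proof.
have [[ru rv] rw] := (radius_ge0 u, radius_ge0 v, radius_ge0 w).
have [Duv Dvw] := (within_layer_ge0 u v, within_layer_ge0 v w).
rewrite /layered_dist.
case: (eqVneq (layer u) (layer v)) => [uv|nuv];
  case: (eqVneq (layer v) (layer w)) => [vw|nvw].
- rewrite uv vw eqxx.
  have := within_layer_triangle uv vw; rewrite -(layer_radius uv).
  by rewrite !minEle; do ?case: ifPn => ?; lra.
- rewrite uv. rewrite (negPf nvw) (layer_radius uv) !minEle !maxEle.
  by do ?case: ifPn => ?; lra.
- rewrite -vw. rewrite (negPf nuv) (layer_radius vw) !minEle !maxEle.
  by do ?case: ifPn => ?; lra.
- case: eqP => [uw|_]; last first.
    by rewrite !maxEle; do ?case: ifPn => ?; lra.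
  rewrite !minEle !maxEle -(layer_radius uw).
  by do ?case: ifPn => ?; lra.
Qed.

HB.instance Definition _ := @isMetric.Build R L layered_dist
  layered_dist_xx layered_dist_eq0 layered_dist_sym layered_dist_triangle.

Lemma layered_nbhsP (u : L) (U : set L) :
  nbhs u U <-> exists2 r, 0 < r & forall v, layered_dist u v < r -> U v.
Proof.
by rewrite -nbhs_ballE; split=> -[r r0 rU]; exists r => // v; exact: rU.
Qed.

Hypothesis i_locally_constant : forall x, nbhs x [set y | i y = i x].

Lemma layered_nbhs_Some x (U : set L) :
  nbhs (Some x : L) U <-> nbhs x [set y | U (Some y)].
Proof.
split.
  move=> /layered_nbhsP[r r0 rU].
  apply: (@filterS _ (nbhs x) _
    ([set y | i y = i x] `&` [set y | d x y < r])); last first.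
    by apply: filterI => //; exact: nbhs_dist_ball.
  move=> y [iy xy]; apply: rU; rewrite /layered_dist /= iy eqxx.
  by rewrite gt_min xy.
move=> /(dist_nbhsP dX)[r r0 rU]; apply/layered_nbhsP.
exists (Num.min r (radius (Some x))).
  by rewrite lt_min r0 /= invr_gt0.
move=> v; rewrite /layered_dist; case: eqP => [|_]; last first.
  by rewrite lt_min !gt_max ltxx !andbF.
case: v => [y|//] _ /=; rewrite lt_min => /andP[+ xy].
have {}xy : d x y < (i x).+1%:R^-1 by move: xy; rewrite gt_min ltxx orbF.
by rewrite (min_idPl (ltW xy)); exact: rU.
Qed.

Lemma layered_nbhs_None (U : set L) :
  nbhs (None : L) U <->
    U None /\ exists N : nat, forall x, (N < i x)%N -> U (Some x).
Proof.
split.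
  move=> nU; split; first exact: nbhs_singleton nU.
  move: nU => /layered_nbhsP[r r0 rU]; have [N Nr] := small_inv r0.
  exists N => x Nx; apply: rU; rewrite /layered_dist /= gt_max r0 /=.
  apply: lt_trans Nr; rewrite ltf_pV2 ?posrE//.
  by rewrite ltr_nat.
move=> [UN [N NU]]; apply/layered_nbhsP; exists (N.+1%:R^-1) => //.
move=> [x|//]; rewrite /layered_dist /= gt_max => /andP[_].
by rewrite ltf_pV2 ?posrE// ltr_nat ltnS; exact: NU.
Qed.

Lemma layered_space_metrizable : metrizable R L.
Proof.
exists L; exists id; split; first by move=> u.
by exists id; split => // u.
Qed.

End layered_space.

Section layered_extension.
Variables (R : realType) (X : topologicalType).
Hypotheses (mX : metrizable R X) (X0 : has_clopen_base X).
Hypothesis (lcX : locally_compact [set: X]).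

(** The set A minus U is relatively compact exactly when U contains all layers of
A beyond some rank, and these U are the traces on X of the neighbourhoods of the
point in the layered space.  Density of X in it holds because A is not relatively compact. *)
Lemma admissible_represented (A : set X) : admissible A ->
  exists e : one_point_extension R X, represents e A.
Proof.
move=> [clA sA nrA]; have [d dX] := metrizable_distance mX.
have [i li] := sigma_compact_layering X0 lcX clA sA.
have [iop i0 ic] := li.
pose L := layered_space dX i; pose emb (x : X) : L := Some x.
have emb_inj : injective emb by move=> x y [].
have emb_open (U : set X) : open U <-> exists2 V : set L, open V & U = emb @^-1` V.
  split=> [oU|[V oV ->]].
    exists (emb @` U); last first.
      by apply/seteqP; split=> [x Ux|x [y Uy [<-]]//]; exists x.
    rewrite openE => _ [x Ux <-].
    apply: (layered_nbhs_Some (dX := dX) iop x _).2.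
    apply: (@filterS _ (nbhs x) _ U) => [y Uy|]; first by exists y.
    exact: open_nbhs_nbhs.
  rewrite openE => x Vx; apply: (layered_nbhs_Some (dX := dX) iop x _).1.
  by apply: open_nbhs_nbhs; split.
have emb_range : range emb = ~` [set (None : L)].
  apply/seteqP; split=> [u [x _ <-] //|[x _|/(_ erefl)[]]].
  by exists x.
have rep (U : set X) : nbhs (None : L) (emb @` U `|` [set None]) <->
    relatively_compact (A `\` U).
  rewrite layered_nbhs_None; split=> [[_ [N NU]]|rAU].
    apply: relatively_compact_sub (ic N) => x [Ax nUx] /=.
    rewrite lt0n; apply/andP; split.
      by apply/eqP => /i0; apply.
    rewrite leqNgt; apply/negP => /NU[[y Uy [yx]]|//].
    by apply: nUx; rewrite -yx.
  split; first by right.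
  have [N NP] := layers_bounded li rAU; exists N => x Nx; left; exists x => //.
  have Ax : A x by apply: contrapT => /i0 ix; rewrite ix in Nx.
  by apply: contrapT => nUx; move: Nx; rewrite ltnNge NP.
have emb_dense : dense (range emb).
  move=> G [[x|] Gu] oG; first by exists (Some x); split => //; exists x.
  apply: contrapT => nG; apply: nrA; rewrite -(setD0 A); apply/rep.
  apply: (@filterS _ (nbhs (None : L)) _ G).
    by move=> [x Gx|_]; [case: nG; exists (Some x); split => //; exists x|right].
  exact: open_nbhs_nbhs.
exists (Build_one_point_extension emb_inj emb_open emb_range emb_dense
  (layered_space_metrizable i dX)).
exact: rep.
Qed.

End layered_extension.

(** * Matching the points of two remainders *)

Section transport.
Variables (R : realType) (X Y : topologicalType).
Hypotheses (X0 : has_clopen_base X) (lcX : locally_compact [set: X]).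
Hypotheses (Y0 : has_clopen_base Y) (lcY : locally_compact [set: Y]).
Variables (I : choiceType) (a : I -> set X) (b : I -> set Y).
Hypotheses (adm_a : forall i, admissible (a i)).
Hypotheses (adm_b : forall i, admissible (b i)).
Hypothesis onto_a : forall A, admissible A -> exists i, a i = A.
Hypothesis onto_b : forall B, admissible B -> exists i, b i = B.
Hypothesis le_ab : forall i j,
  relatively_compact (a i `\` a j) <-> relatively_compact (b i `\` b j).

Lemma ends_admissible_sub (A B : set X) (z : omega_sigma_remainder R X) :
  admissible A -> clopen B -> B `<=` A -> ends B z -> admissible B.
Proof.
move=> [_ sA _] clB BA hB; split => //; last exact: ends_not_relatively_compact hB.
by apply: sigma_compact_subclosed BA sA; case: clB.
Qed.

(** Finitely many memberships of z are decided by a single admissible set,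
obtained from A by intersecting with, or removing, one a i after the other. *)
Lemma admissible_refinement (z : omega_sigma_remainder R X) (A : set X)
    (D : seq I) : admissible A -> ends A z ->
  exists A' : set X, [/\ admissible A', ends A' z & forall i, i \in D ->
    (ends (a i) z -> A' `<=` a i) /\ (~ ends (a i) z -> A' `&` a i = set0)].
Proof.
move=> admA hA; elim: D => [|i D [B [admB hB BD]]]; first by exists A.
have [clB _ _] := admB; have [cli _ _] := adm_a i.
have [hi|nhi] := pselect (ends (a i) z).
  have hBi := endsI hB hi; exists (B `&` a i); split => //.
    by apply: (@ends_admissible_sub B) hBi => //; exact: clopenI.
  move=> j; rewrite in_cons => /orP[/eqP ->|/BD[hj nj]].
    by split => // _ x [].
  split=> [/hj Bj|/nj Bj]; first by move=> x [/Bj].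
  by rewrite -subset0 -Bj => x [[Bx _] jx].
have [//|hBi] := ends_split cli hB.
exists (B `\` a i); split => //.
  apply: (@ends_admissible_sub B) hBi => //.
  by rewrite setDE; apply: clopenI => //; exact: clopenC.
move=> j; rewrite in_cons => /orP[/eqP ->|/BD[hj nj]].
  by split => // _; rewrite -subset0 => x [[]].
split=> [/hj Bj|/nj Bj]; first by move=> x [/Bj].
by rewrite -subset0 -Bj => x [[Bx _] jx].
Qed.

(** If z is in no [ends (a i)], the point at infinity matches it.  Otherwise take
an admissible a k deciding the memberships of z, and any w in [ends (b k)].  Sets
above a k go to sets above b k.  For a i disjoint from a k, the point w cannot be
in [ends (b i)]: the intersection of b k and b i would be an admissible b j, and
a j would be below both a k and a i, hence relatively compact. *)
Lemma ends_matching (z : omega_sigma_remainder R X) (D : seq I) :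
  exists w : omega_sigma_remainder R Y,
    forall i, i \in D -> (ends (b i) w <-> ends (a i) z).
Proof.
have [[i0 hi0]|nhat] := pselect (exists i, ends (a i) z); last first.
  have nr : (~` range (@omega_sigma_emb R Y)) None by move=> [].
  exists (exist _ None (mem_set nr)) => i _; split=> [[]//|hi].
  by case: nhat; exists i.
have [A [admA hA AD]] := admissible_refinement D (adm_a i0) hi0.
have [k kA] := onto_a admA; rewrite -{}kA in admA hA AD.
have [clk sk nrk] := adm_b k.
have [w hw] := ends_nonempty R Y0 lcY clk sk nrk.
exists w => i /AD[hi nhi]; have [cli _ _] := adm_b i; split=> [hbi|/hi kis].
  apply: contrapT => /nhi ki0.
  have hki := endsI hw hbi.
  have clki := clopenI clk cli.
  have [j jE] : exists j, b j = b k `&` b i.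
    apply: onto_b; split => //; last exact: ends_not_relatively_compact hki.
    by apply: sigma_compact_subclosed sk; [case: clki|move=> y []].
  have rjk : relatively_compact (a j `\` a k).
    apply/le_ab; rewrite jE.
    apply: relatively_compact_sub (relatively_compact0 Y).
    by move=> y [[]].
  have rji : relatively_compact (a j `\` a i).
    apply/le_ab; rewrite jE.
    apply: relatively_compact_sub (relatively_compact0 Y).
    by move=> y [[]].
  have [_ _] := adm_a j; apply.
  apply: relatively_compact_sub (relatively_compactU rjk rji) => x jx.
  have [kx|] := pselect (a k x); last by left.
  right; split => // ix; have : (a k `&` a i) x by [].
  by rewrite ki0.
apply: ends_le hw => //; apply/le_ab.
apply: relatively_compact_sub (relatively_compact0 X) => x [kx]; apply.
exact: kis.
Qed.

End transport.

(** * Classes of extensions *)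

Section classes.
Variables (R : realType) (X : topologicalType).
Implicit Types E : lc_extensions R X.

Definition class_represented (A : set X) E : Prop :=
  exists2 e, sval (sval E) e & represents e A.

Lemma extension_class_le (C : extensions R X) (e1 e2 : one_point_extension R X) :
  sval C e1 -> sval C e2 -> ext_le e1 e2.
Proof.
have [e Ce] := svalP C; rewrite Ce => /ext_equiv_le[_ e1e] /ext_equiv_le[ee2 _].
exact: ext_le_trans ee2.
Qed.

Lemma class_represented_le E1 E2 (A1 A2 : set X) :
  class_represented A1 E1 -> class_represented A2 E2 ->
  lc_extensions_le E1 E2 <-> relatively_compact (A2 `\` A1).
Proof.
move=> [e1 Ee1 r1] [e2 Ee2 r2]; split.
  move=> [e1' [e2' [Ee1' Ee2' le12]]]; apply/(ext_le_represents r1 r2).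
  apply: ext_le_trans (extension_class_le Ee1 Ee1') _.
  exact: ext_le_trans le12 (extension_class_le Ee2' Ee2).
by move=> /(ext_le_represents r1 r2) le12; exists e1, e2.
Qed.

Hypotheses (mX : metrizable R X) (X0 : has_clopen_base X).
Hypothesis (lcX : locally_compact [set: X]).

Lemma class_represented_admissible E :
  exists2 A, admissible A & class_represented A E.
Proof.
have [e [Ee lce]] := svalP E.
by have [A admA rA] := locally_compact_represented X0 lcX lce; exists A => //; exists e.
Qed.

Lemma admissible_class_represented A :
  admissible A -> exists E, class_represented A E.
Proof.
move=> admA; have [e rA] := admissible_represented mX X0 lcX admA.
have ee : ext_equiv e e.
  exists id => //; split; first by move=> y.
  by exists id; split => // y.
have lce : locally_compact [set: e].
  by apply: represents_locally_compact rA => //; case: admA => -[].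
pose C : extensions R X := exist _ (ext_equiv e) (ex_intro _ e erefl).
by exists (exist _ C (ex_intro _ e (conj ee lce))); exists e.
Qed.

End classes.

Theorem theorem4p1 (R : realType) (X Y : topologicalType)
    (X_metrizable : metrizable R X) (Y_metrizable : metrizable R Y)
    (X_zero_dim : has_clopen_base X) (Y_zero_dim : has_clopen_base Y)
    (X_locally_compact : locally_compact [set: X])
    (Y_locally_compact : locally_compact [set: Y])
    (X_nonseparable : ~ separable X) (Y_nonseparable : ~ separable Y) :
  order_isomorphic (@lc_extensions_le R X) (@lc_extensions_le R Y) ->
  homeomorphic (omega_sigma_remainder R X) (omega_sigma_remainder R Y).
Proof.
move=> [f [g fK gK] f_le].
(* Pairs of representatives of corresponding classes index both families. *)
pose matched (AB : set X * set Y) := [/\ admissible AB.1, admissible AB.2 &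
  exists2 E, class_represented AB.1 E & class_represented AB.2 (f E)].
pose I : choiceType := set_type matched.
pose a (i : I) := (\val i).1; pose b (i : I) := (\val i).2.
have adm_a i : admissible (a i) by have [] := set_mem (valP i).
have adm_b i : admissible (b i) by have [] := set_mem (valP i).
have onto_a A : admissible A -> exists i, a i = A.
  move=> admA; have [E AE] :=
    admissible_class_represented X_metrizable X_zero_dim X_locally_compact admA.
  have [B admB BE] :=
    class_represented_admissible Y_zero_dim Y_locally_compact (f E).
  have AB : matched (A, B) by split => //; exists E.
  by exists (exist _ (A, B) (mem_set AB)).
have onto_b B : admissible B -> exists i, b i = B.
  move=> admB; have [E BE] :=
    admissible_class_represented Y_metrizable Y_zero_dim Y_locally_compact admB.
  have [A admA AE] :=
    class_represented_admissible X_zero_dim X_locally_compact (g E).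
  have AB : matched (A, B) by split => //; exists (g E) => //=; rewrite gK.
  by exists (exist _ (A, B) (mem_set AB)).
have le_ab i j :
    relatively_compact (a i `\` a j) <-> relatively_compact (b i `\` b j).
  have [_ _ [E aE bE]] := set_mem (valP i).
  have [_ _ [F aF bF]] := set_mem (valP j).
  by rewrite -(class_represented_le aF aE) f_le (class_represented_le bF bE).
apply: (@homeomorphic_of_matching I (omega_sigma_remainder R X)
  (omega_sigma_remainder R Y) (fun i => @ends R X (a i)) (fun i => @ends R Y (b i))).
- exact: remainder_compact.
- exact: remainder_compact.
- by move=> i; have [? ? _] := adm_a i; exact: ends_clopen.
- by move=> i; have [? ? _] := adm_b i; exact: ends_clopen.
- move=> s u su; have [A [clA sA nA]] :=
    ends_separates X_zero_dim X_locally_compact X_metrizable su.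
  have [i iA] : exists i, a i = A; last by exists i; rewrite iA.
  apply: onto_a; split => // rA; apply: nA.
  by split=> /(ends_not_relatively_compact clA).
- move=> t u tu; have [B [clB sB nB]] :=
    ends_separates Y_zero_dim Y_locally_compact Y_metrizable tu.
  have [i iB] : exists i, b i = B; last by exists i; rewrite iB.
  apply: onto_b; split => // rB; apply: nB.
  by split=> /(ends_not_relatively_compact clB).
- by move=> s D; exact: ends_matching.
- by move=> t D; apply: ends_matching => // i j; rewrite le_ab.
Qed.
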